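(* Let $k$ be a commutative ring with $1$ and let $(A,C)_\psi$ be an entwining structure over $k$. The functor $-\otimes C:\mathbf{M}_A\to\mathbf{M}_A^C(\psi)$ is separable if and only if there exists a normalised integral in $(A,C)_\psi$.
   Context: Algebras are associative unital $k$-algebras, coalgebras coassociative counital $k$-coalgebras, $\otimes=\otimes_k$; $\mu_A,1_A$ are product and unit, $\Delta_C,\varepsilon_C$ coproduct and counit. An entwining structure $(A,C)_\psi$ is an algebra $A$, a coalgebra $C$ and a $k$-linear map $\psi:C\otimes A\to A\otimes C$, written $\psi(c\otimes a)=a_\alpha\otimes c^\alpha$ (summation understood), with $\psi\circ(C\otimes\mu_A)=(\mu_A\otimes C)\circ(A\otimes\psi)\circ(\psi\otimes A)$, $\psi\circ(C\otimes1_A)=1_A\otimes C$, $(A\otimes\Delta_C)\circ\psi=(\psi\otimes C)\circ(C\otimes\psi)\circ(\Delta_C\otimes A)$, $(A\otimes\varepsilon_C)\circ\psi=\varepsilon_C\otimes A$ (the name of a module also denotes its identity map). $\mathbf{M}_A$ is the category of right $A$-modules. $\mathbf{M}_A^C(\psi)$ is the category of entwined modules: right $A$-modules and right $C$-comodules $M$, with coaction $\rho^M(m)=m_{(0)}\otimes m_{(1)}$, such that $\rho^M(m\cdot a)=m_{(0)}\cdot a_\alpha\otimes m_{(1)}^\alpha$; morphisms are right $A$-linear right $C$-colinear maps. For a right $A$-module $M$, $M\otimes C$ is an entwined module with coaction $M\otimes\Delta_C$ and action $(m\otimes c)\cdot a=m\cdot a_\alpha\otimes c^\alpha$; this defines the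 functor $-\otimes C$. A covariant functor $F:\mathcal C\to\mathcal D$ is separable if the natural transformation $\mathrm{Hom}_{\mathcal C}(-,-)\to\mathrm{Hom}_{\mathcal D}(F(-),F(-))$ splits (has a natural left inverse). An integral in $(A,C)_\psi$ is an element $\mathfrak z=\sum_ia_i\otimes c_i\in A\otimes C$ such that $\sum_iaa_i\otimes c_i=\sum_ia_i\psi(c_i\otimes a)$ for all $a\in A$. It is normalised if $\sum_ia_i\varepsilon_C(c_i)=1$. *)

(* Defs.v *)
From HB Require Import structures.
From mathcomp Require Import all_boot all_algebra.
From mathcomp Require Import boolp.

Set Implicit Arguments.
Unset Strict Implicit.
Unset Printing Implicit Defensive.

Import GRing.Theory.
Local Open Scope ring_scope.
Local Open Scope quotient_scope.

Section Tensor.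
Variables (k : comPzRingType) (U V : lmodType k).
Implicit Types (s t : seq (U * V)) (u : U) (v : V) (a : k).

(* A sequence of pairs stands for the formal sum of the corresponding pure
   tensors; tens_eq is the congruence generated by commutativity of addition
   and by k-balanced bilinearity. *)
Inductive tens_eq : seq (U * V) -> seq (U * V) -> Prop :=
| TensRefl s : tens_eq s s
| TensSym s t : tens_eq s t -> tens_eq t s
| TensTrans t s r : tens_eq s t -> tens_eq t r -> tens_eq s r
| TensCat s s' t t' : tens_eq s s' -> tens_eq t t' -> tens_eq (s ++ t) (s' ++ t')
| TensC s t : tens_eq (s ++ t) (t ++ s)
| Tens0 v : tens_eq [:: (0, v)] [::]
| TensDl u u' v : tens_eq [:: (u + u', v)] [:: (u, v); (u', v)]
| TensDr u v v' : tens_eq [:: (u, v + v')] [:: (u, v); (u, v')]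
| TensZ a u v : tens_eq [:: (a *: u, v)] [:: (u, a *: v)].

Definition tens_rel : rel (seq (U * V)) := fun s t => `[< tens_eq s t >].

Lemma tens_rel_refl : reflexive tens_rel.
Proof. by move=> s; apply/asboolP; apply: TensRefl. Qed.

Lemma tens_rel_sym : symmetric tens_rel.
Proof. by move=> s t; apply/asboolP/asboolP => /TensSym. Qed.

Lemma tens_rel_trans : transitive tens_rel.
Proof.
by move=> t s r /asboolP st /asboolP tr; apply/asboolP; apply: TensTrans st tr.
Qed.

Canonical tens_equiv := EquivRel tens_rel tens_rel_refl tens_rel_sym tens_rel_trans.

Definition tensor_quot : Type := {eq_quot tens_equiv}.

HB.instance Definition _ := Choice.on tensor_quot.
HB.instance Definition _ := EqQuotient.on tensor_quot.

Lemma tensor_eqP s t : \pi_tensor_quot s = \pi_tensor_quot t <-> tens_eq s t.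
Proof. by split=> [/eqmodP/asboolP|st]; [|apply/eqmodP/asboolP]. Qed.

Definition tens_zero : tensor_quot := \pi_tensor_quot [::].
Definition tens_add (x y : tensor_quot) : tensor_quot :=
  \pi_tensor_quot (repr x ++ repr y).
Definition tens_scale (a : k) (x : tensor_quot) : tensor_quot :=
  \pi_tensor_quot [seq (a *: p.1, p.2) | p <- repr x].
Definition tens_opp (x : tensor_quot) : tensor_quot := tens_scale (-1) x.

Lemma tensorP (x : tensor_quot) : exists s, x = \pi_tensor_quot s.
Proof. by exists (repr x); rewrite reprK. Qed.

Lemma tens_eq_repr s : tens_eq (repr (\pi_tensor_quot s)) s.
Proof. by apply/tensor_eqP; rewrite reprK. Qed.

Lemma tens_add_pi s t :
  tens_add (\pi_tensor_quot s) (\pi_tensor_quot t) = \pi_tensor_quot (s ++ t).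
Proof. by apply/tensor_eqP; apply: TensCat; apply: tens_eq_repr. Qed.

Lemma tens_eq_scale a s t : tens_eq s t ->
  tens_eq [seq (a *: p.1, p.2) | p <- s] [seq (a *: p.1, p.2) | p <- t].
Proof.
elim=> {s t} [s|s t _|t s r _ st _ tr|s s' t t' _ ss _ tt|s t|v|u u' v|u v v'|b u v] /=.
- exact: TensRefl.
- exact: TensSym.
- exact: TensTrans st tr.
- by rewrite !map_cat; apply: TensCat.
- by rewrite !map_cat; apply: TensC.
- by rewrite scaler0; apply: Tens0.
- by rewrite scalerDr; apply: TensDl.
- exact: TensDr.
- by rewrite scalerA mulrC -scalerA; apply: TensZ.
Qed.

Lemma tens_scale_pi a s :
  tens_scale a (\pi_tensor_quot s) = \pi_tensor_quot [seq (a *: p.1, p.2) | p <- s].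
Proof. by apply/tensor_eqP; apply: tens_eq_scale; apply: tens_eq_repr. Qed.

Lemma tens_addA : associative tens_add.
Proof.
move=> x y z; have [s ->] := tensorP x; have [t ->] := tensorP y.
by have [r ->] := tensorP z; rewrite !tens_add_pi catA.
Qed.

Lemma tens_addC : commutative tens_add.
Proof. by move=> x y; apply/tensor_eqP; apply: TensC. Qed.

Lemma tens_add0 : left_id tens_zero tens_add.
Proof. by move=> x; have [s ->] := tensorP x; rewrite tens_add_pi. Qed.

Lemma tens_eq_map_add (f g h : U * V -> U * V) s :
  (forall p, tens_eq [:: f p] [:: g p; h p]) ->
  tens_eq (map f s) (map g s ++ map h s).
Proof.
move=> fgh; elim: s => [|p s ih] /=; first exact: TensRefl.
apply: (TensTrans (TensCat (fgh p) ih)) => /=.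
apply: (TensCat (TensRefl [:: g p])).
rewrite -[h p :: _]cat1s -[h p :: map h s]cat1s !catA.
exact: TensCat (TensC _ _) (TensRefl _).
Qed.

Lemma tens_scaleDl x : {morph tens_scale^~ x : a b / a + b >-> tens_add a b}.
Proof.
move=> a b; have [s ->] := tensorP x; rewrite !tens_scale_pi tens_add_pi.
apply/tensor_eqP; apply: tens_eq_map_add => p.
by rewrite scalerDl; apply: TensDl.
Qed.

Lemma tens_scale0 x : tens_scale 0 x = tens_zero.
Proof.
apply/tensor_eqP; elim: (repr x) => [|p s ih] /=; first exact: TensRefl.
by rewrite scale0r -cat1s -[[::]]cat0s; apply: TensCat => //; apply: Tens0.
Qed.

Lemma tens_scale1 : left_id 1 tens_scale.
Proof.
move=> x; rewrite -[RHS]reprK; congr (\pi_tensor_quot _).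
by rewrite -[RHS]map_id; apply: eq_map => -[u v] /=; rewrite scale1r.
Qed.

Lemma tens_scaleA a b x : tens_scale a (tens_scale b x) = tens_scale (a * b) x.
Proof.
have [s ->] := tensorP x; rewrite !tens_scale_pi -map_comp; congr (\pi_tensor_quot _).
by apply: eq_map => p /=; rewrite scalerA.
Qed.

Lemma tens_scaleDr : right_distributive tens_scale tens_add.
Proof.
move=> a x y; have [s ->] := tensorP x; have [t ->] := tensorP y.
by rewrite !(tens_scale_pi, tens_add_pi) map_cat.
Qed.

Lemma tens_addN : left_inverse tens_zero tens_opp tens_add.
Proof.
by move=> x; rewrite /tens_opp -{2}[x]tens_scale1 -tens_scaleDl addNr tens_scale0.
Qed.

HB.instance Definition _ :=
  GRing.isZmodule.Build tensor_quot tens_addA tens_addC tens_add0 tens_addN.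
HB.instance Definition _ :=
  GRing.Zmodule_isLmodule.Build k tensor_quot tens_scaleA tens_scale1 tens_scaleDr
    tens_scaleDl.

Definition tensor : lmodType k := GRing.Lmodule.clone k tensor_quot _.

Definition tens u v : tensor := \pi_tensor_quot [:: (u, v)].

Lemma tensor_sum (x : tensor) : x = \sum_(p <- repr (x : tensor_quot)) tens p.1 p.2.
Proof.
rewrite -{1}[x](@reprK _ tensor_quot).
elim: (repr (x : tensor_quot)) => [|[u v] s ih]; first by rewrite big_nil.
by rewrite big_cons -ih; symmetry; apply: tens_add_pi.
Qed.

Lemma tensor_ind (P : tensor -> Prop) :
  (forall u v, P (tens u v)) -> (forall x y, P x -> P y -> P (x + y)) ->
  forall x, P x.
Proof.
move=> Pt PD x; rewrite (tensor_sum x); elim: (repr (x : tensor_quot)) => [|p s ih].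
  rewrite big_nil -[0](scale0r (tens 0 0)).
  have -> : 0 *: tens 0 0 = tens (0 *: 0) 0 by symmetry; apply/esym/tens_scale_pi.
  exact: Pt.
by rewrite big_cons; apply: PD.
Qed.

Lemma tensDl u u' v : tens (u + u') v = tens u v + tens u' v.
Proof.
by symmetry; etransitivity; [apply: tens_add_pi | apply/tensor_eqP/TensSym/TensDl].
Qed.

Lemma tensDr u v v' : tens u (v + v') = tens u v + tens u v'.
Proof.
by symmetry; etransitivity; [apply: tens_add_pi | apply/tensor_eqP/TensSym/TensDr].
Qed.

Lemma tensZl a u v : tens (a *: u) v = a *: tens u v.
Proof. by symmetry; apply: tens_scale_pi. Qed.

Lemma tensZr a u v : tens u (a *: v) = a *: tens u v.
Proof. by rewrite -tensZl; symmetry; apply/tensor_eqP/TensZ. Qed.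

Lemma tens0l v : tens 0 v = 0.
Proof. by rewrite -(scale0r 0) tensZl scale0r. Qed.

Lemma tens0r u : tens u 0 = 0.
Proof. by rewrite -(scale0r 0) tensZr scale0r. Qed.

Definition is_bilinear (W : lmodType k) (f : U -> V -> W) :=
  (forall v, linear (f^~ v)) /\ (forall u, linear (f u)).

Lemma tens_bilinear : is_bilinear tens.
Proof.
split=> [v a u u'|u a v v']; first by rewrite tensDl tensZl.
by rewrite tensDr tensZr.
Qed.

Section Lift.
Variables (W : lmodType k) (f : U -> V -> W) (fP : is_bilinear f).

Definition tlift_seq s : W := \sum_(p <- s) f p.1 p.2.

Lemma tlift_seq_eq s t : tens_eq s t -> tlift_seq s = tlift_seq t.
Proof.
have fDl u u' v : f (u + u') v = f u v + f u' v.
  by have := fP.1 v 1 u u'; rewrite !scale1r.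
have fDr u v v' : f u (v + v') = f u v + f u v'.
  by have := fP.2 u 1 v v'; rewrite !scale1r.
have f0l v : f 0 v = 0 by apply: (addrI (f 0 v)); rewrite -fDl !addr0.
have f0r u : f u 0 = 0 by apply: (addrI (f u 0)); rewrite -fDr !addr0.
have fZl a u v : f (a *: u) v = a *: f u v.
  by have := fP.1 v a u 0; rewrite f0l !addr0.
have fZr a u v : f u (a *: v) = a *: f u v.
  by have := fP.2 u a v 0; rewrite f0r !addr0.
rewrite /tlift_seq.
elim=> {s t} [s|s t _|t s r _ st _ tr|s s' t t' _ ss _ tt|s t|v|u u' v|u v v'|b u v] //=.
- by rewrite st.
- by rewrite !big_cat /= ss tt.
- by rewrite !big_cat /= addrC.
- by rewrite big_seq1 big_nil f0l.
- by rewrite big_seq1 !big_cons big_nil addr0 fDl.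
- by rewrite big_seq1 !big_cons big_nil addr0 fDr.
- by rewrite !big_seq1 fZl fZr.
Qed.

(* [fP] is only used in the proofs, but has to be an argument of [tlift] for
   its linearity to be inferred. *)
Definition tlift (_ : is_bilinear f) (x : tensor) : W :=
  tlift_seq (repr (x : tensor_quot)).

Lemma tlift_pi s : tlift fP (\pi_tensor_quot s) = tlift_seq s.
Proof. by apply: tlift_seq_eq; apply: tens_eq_repr. Qed.

Lemma tlift_is_linear : linear (tlift fP).
Proof.
move=> a x y; have [s ->] := tensorP x; have [t ->] := tensorP y.
have -> : a *: \pi_tensor_quot s + \pi_tensor_quot t =
    \pi_tensor_quot ([seq (a *: p.1, p.2) | p <- s] ++ t) :> tensor.
  rewrite -tens_add_pi -tens_scale_pi; reflexivity.
rewrite !tlift_pi /tlift_seq big_cat /= big_map scaler_sumr; congr (_ + _).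
apply: eq_bigr => p _ /=.
have f0l v : f 0 v = 0.
  by have := fP.1 v (-1) 0 0; rewrite scaler0 addr0 scaleN1r addNr.
by have := fP.1 p.2 a p.1 0; rewrite f0l !addr0.
Qed.

HB.instance Definition _ :=
  GRing.isLinear.Build k tensor W *:%R (tlift fP) tlift_is_linear.

Lemma tliftE u v : tlift fP (tens u v) = f u v.
Proof. by rewrite tlift_pi /tlift_seq big_seq1. Qed.

End Lift.

Lemma tensor_ext (W : lmodType k) (f g : {linear tensor -> W}) :
  (forall u v, f (tens u v) = g (tens u v)) -> f =1 g.
Proof.
move=> fg x; rewrite (tensor_sum x) !raddf_sum.
by apply: eq_bigr => p _; apply: fg.
Qed.

End Tensor.
Arguments tensor : simpl never.

Notation "U ⊗ V" := (tensor U V) (at level 40, left associativity).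
Notation "u ⊗ₜ v" := (tens u v) (at level 40, left associativity).

Section TensorMaps.
Variable k : comPzRingType.
Implicit Types U V W : lmodType k.

Section Map.
Variables (U U' V V' : lmodType k).
Variables (f : {linear U -> U'}) (g : {linear V -> V'}).

Lemma tmap_bilinear : is_bilinear (W := U' ⊗ V') (fun u v => f u ⊗ₜ g v).
Proof.
split=> [v a u u'|u a v v']; first by rewrite linearP tensDl tensZl.
by rewrite linearP tensDr tensZr.
Qed.

Definition tmap : U ⊗ V -> U' ⊗ V' := tlift tmap_bilinear.
HB.instance Definition _ := GRing.Linear.on tmap.

Lemma tmapE u v : tmap (u ⊗ₜ v) = f u ⊗ₜ g v.
Proof. exact: tliftE. Qed.
End Map.

Section Assoc.
Variables U V W : lmodType k.

Lemma tassoc_bilinear1 w :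
  is_bilinear (W := U ⊗ (V ⊗ W)) (fun u v => u ⊗ₜ (v ⊗ₜ w)).
Proof.
split=> [v a u u'|u a v v']; first by rewrite tensDl tensZl.
by rewrite tensDl tensZl tensDr tensZr.
Qed.

Lemma tassoc_bilinear :
  is_bilinear (fun (x : U ⊗ V) (w : W) => tlift (tassoc_bilinear1 w) x).
Proof.
split=> [w|x a w w']; first exact: linearP.
elim/tensor_ind: x => [u v|x y hx hy]; first by rewrite !tliftE !tensDr !tensZr.
by rewrite !linearD /= hx hy addrACA.
Qed.

Definition tassoc : (U ⊗ V) ⊗ W -> U ⊗ (V ⊗ W) := tlift tassoc_bilinear.
HB.instance Definition _ := GRing.Linear.on tassoc.

Lemma tassocE u v w : tassoc ((u ⊗ₜ v) ⊗ₜ w) = u ⊗ₜ (v ⊗ₜ w).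
Proof. by rewrite [LHS]tliftE [LHS]tliftE. Qed.

Lemma tassocV_bilinear1 u :
  is_bilinear (W := (U ⊗ V) ⊗ W) (fun v w => u ⊗ₜ v ⊗ₜ w).
Proof.
split=> [w a v v'|v a w w']; last by rewrite tensDr tensZr.
by rewrite tensDr tensZr tensDl tensZl.
Qed.

Lemma tassocV_bilinear :
  is_bilinear (fun (u : U) (x : V ⊗ W) => tlift (tassocV_bilinear1 u) x).
Proof.
split=> [x a u u'|u]; last exact: linearP.
elim/tensor_ind: x => [v w|x y hx hy]; first by rewrite !tliftE !tensDl !tensZl.
by rewrite !linearD /= hx hy addrACA.
Qed.

Definition tassocV : U ⊗ (V ⊗ W) -> (U ⊗ V) ⊗ W := tlift tassocV_bilinear.
HB.instance Definition _ := GRing.Linear.on tassocV.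

Lemma tassocVE u v w : tassocV (u ⊗ₜ (v ⊗ₜ w)) = (u ⊗ₜ v) ⊗ₜ w.
Proof. by rewrite [LHS]tliftE [LHS]tliftE. Qed.
End Assoc.
Arguments tassoc {U V W}.
Arguments tassocV {U V W}.

Section Unit.
Variable V : lmodType k.

Lemma tlunit_bilinear : is_bilinear (fun (a : k^o) (v : V) => (a : k) *: v).
Proof.
split=> [v a b c|b a v v']; first by rewrite scalerDl scalerA.
by rewrite scalerDr !scalerA mulrC.
Qed.

Definition tlunit : k^o ⊗ V -> V := tlift tlunit_bilinear.
HB.instance Definition _ := GRing.Linear.on tlunit.

Lemma tlunitE a v : tlunit (a ⊗ₜ v) = (a : k) *: v.
Proof. exact: tliftE. Qed.

Lemma trunit_bilinear : is_bilinear (fun (v : V) (a : k^o) => (a : k) *: v).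
Proof. by case: tlunit_bilinear. Qed.

Definition trunit : V ⊗ k^o -> V := tlift trunit_bilinear.
HB.instance Definition _ := GRing.Linear.on trunit.

Lemma trunitE v a : trunit (v ⊗ₜ a) = (a : k) *: v.
Proof. exact: tliftE. Qed.
End Unit.
Arguments tlunit {V}.
Arguments trunit {V}.

End TensorMaps.
Arguments tmap : simpl never.
Arguments tassoc {k U V W} : simpl never.
Arguments tassocV {k U V W} : simpl never.
Arguments tlunit {k V} : simpl never.
Arguments trunit {k V} : simpl never.

Definition idm (k : comPzRingType) (U : lmodType k) : {linear U -> U} := idfun.
Arguments idm {k} U.

Notation "f ⊗ₘ g" := (tmap f g) (at level 40, left associativity).

Lemma linear_ext (k : comPzRingType) (U V : lmodType k) (f g : {linear U -> V}) :
  f =1 g -> f = g.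
Proof.
case: f g => [f [[f1] [f2]]] [g [[g1] [g2]]] /= /funext fg.
by case: _ / fg g1 g2 => g1 g2; rewrite (Prop_irrelevance g1 f1) (Prop_irrelevance g2 f2).
Qed.

Lemma tmap_id (k : comPzRingType) (U V : lmodType k) : idm U ⊗ₘ idm V =1 id.
Proof.
by move=> x; elim/tensor_ind: x => [u v|x y]; [rewrite tmapE|rewrite linearD /= => -> ->].
Qed.

Lemma tmap_comp (k : comPzRingType) (U U' U'' V V' V'' : lmodType k)
    (f' : {linear U' -> U''}) (f : {linear U -> U'}) (h : {linear U -> U''})
    (g' : {linear V' -> V''}) (g : {linear V -> V'}) (l : {linear V -> V''}) :
  f' \o f =1 h -> g' \o g =1 l ->
  (f' ⊗ₘ g') \o (f ⊗ₘ g) =1 h ⊗ₘ l.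
Proof.
move=> fh gl x /=; elim/tensor_ind: x => [u v|x y]; last by rewrite !linearD /= => -> ->.
by rewrite !tmapE -fh -gl.
Qed.

(* MathComp's [algType] excludes the zero algebra, which has to be allowed
   here, in particular because [k] may be the zero ring. *)
Record algebra (k : comPzRingType) := Algebra {
  alg_car :> lmodType k;
  alg_mul : {linear alg_car ⊗ alg_car -> alg_car};
  alg_one : alg_car;
  alg_mulA : forall a b c,
    alg_mul (alg_mul (a ⊗ₜ b) ⊗ₜ c) = alg_mul (a ⊗ₜ alg_mul (b ⊗ₜ c));
  alg_mul1l : forall a, alg_mul (alg_one ⊗ₜ a) = a;
  alg_mul1r : forall a, alg_mul (a ⊗ₜ alg_one) = a }.

Section AlgebraOfAlgType.
Variables (k : comPzRingType) (A : algType k).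

Lemma algType_mul_bilinear : is_bilinear (fun a b : A => a * b).
Proof.
split=> [b c a a'|a c b b']; first by rewrite mulrDl scalerAl.
by rewrite mulrDr scalerAr.
Qed.

Definition algType_mul : {linear A ⊗ A -> A} := tlift algType_mul_bilinear.

Lemma algType_mulE (a b : A) : algType_mul (a ⊗ₜ b) = a * b.
Proof. exact: tliftE. Qed.

Lemma algType_mulA (a b c : A) :
  algType_mul (algType_mul (a ⊗ₜ b) ⊗ₜ c) =
  algType_mul (a ⊗ₜ algType_mul (b ⊗ₜ c)).
Proof. by rewrite !algType_mulE mulrA. Qed.

Lemma algType_mul1l (a : A) : algType_mul (1 ⊗ₜ a) = a.
Proof. by rewrite algType_mulE mul1r. Qed.

Lemma algType_mul1r (a : A) : algType_mul (a ⊗ₜ 1) = a.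
Proof. by rewrite algType_mulE mulr1. Qed.

Definition algType_algebra : algebra k :=
  Algebra algType_mulA algType_mul1l algType_mul1r.
End AlgebraOfAlgType.

Record coalgebra (k : comPzRingType) := Coalgebra {
  coalg_car :> lmodType k;
  coalg_comul : {linear coalg_car -> coalg_car ⊗ coalg_car};
  coalg_counit : {linear coalg_car -> k^o};
  coalg_comulA : forall c,
    tassoc ((coalg_comul ⊗ₘ idm coalg_car) (coalg_comul c)) =
    (idm coalg_car ⊗ₘ coalg_comul) (coalg_comul c);
  coalg_counitl : forall c,
    tlunit ((coalg_counit ⊗ₘ idm coalg_car) (coalg_comul c)) = c;
  coalg_counitr : forall c,
    trunit ((idm coalg_car ⊗ₘ coalg_counit) (coalg_comul c)) = c }.

Notation "'μ[' A ]" := (alg_mul A) (format "'μ[' A ]").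
Notation "'Δ[' C ]" := (coalg_comul C) (format "'Δ[' C ]").
Notation "'ε[' C ]" := (coalg_counit C) (format "'ε[' C ]").

(* The associativity and unit isomorphisms [tassoc], [tassocV], [tlunit] and
   [trunit] make explicit the identifications left implicit on paper. *)
Record entwining (k : comPzRingType) (A : algebra k) (C : coalgebra k) :=
  Entwining {
  psi :> {linear C ⊗ A -> A ⊗ C};
  psi_mul : forall x : C ⊗ (A ⊗ A),
    psi ((idm C ⊗ₘ μ[A]) x) =
    (μ[A] ⊗ₘ idm C) (tassocV ((idm A ⊗ₘ psi) (tassoc
      ((psi ⊗ₘ idm A) (tassocV x)))));
  psi_one : forall c : C, psi (c ⊗ₜ alg_one A) = alg_one A ⊗ₜ c;
  psi_comul : forall x : C ⊗ A,
    (idm A ⊗ₘ Δ[C]) (psi x) =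
    tassoc ((psi ⊗ₘ idm C) (tassocV ((idm C ⊗ₘ psi) (tassoc
      ((Δ[C] ⊗ₘ idm A) x)))));
  psi_counit : forall x : C ⊗ A,
    trunit ((idm A ⊗ₘ ε[C]) (psi x)) = tlunit ((ε[C] ⊗ₘ idm A) x) }.

Record category := Category {
  obj :> Type;
  hom : obj -> obj -> Type;
  idC : forall X, hom X X;
  compC : forall X Y Z, hom Y Z -> hom X Y -> hom X Z;
  comp1C : forall X Y (f : hom X Y), compC (idC Y) f = f;
  compC1 : forall X Y (f : hom X Y), compC f (idC X) = f;
  compCA : forall X Y Z T (h : hom Z T) (g : hom Y Z) (f : hom X Y),
    compC h (compC g f) = compC (compC h g) f }.

Notation "g \oc f" := (compC g f) (at level 50, left associativity).

Record functor (C D : category) := Functor {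
  fobj :> C -> D;
  fmap : forall X Y : C, hom X Y -> hom (fobj X) (fobj Y);
  fmap1 : forall X, fmap (idC X) = idC (fobj X);
  fmapC : forall X Y Z (g : hom Y Z) (f : hom X Y),
    fmap (g \oc f) = fmap g \oc fmap f }.

(* [fmap] is a natural transformation Hom_C(-,-) -> Hom_D(F-,F-) of functors
   C^op x C -> Set; P is a natural left inverse of it. *)
Definition separable (C D : category) (F : functor C D) : Prop :=
  exists P : forall X Y : C, hom (F X) (F Y) -> hom X Y,
    (forall (X X' Y Y' : C) (f : hom X' X) (g : hom Y Y') (h : hom (F X) (F Y)),
       P X' Y' (fmap F g \oc h \oc fmap F f) = g \oc P X Y h \oc f) /\
    (forall (X Y : C) (f : hom X Y), P X Y (fmap F f) = f).

Section RightModules.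
Variables (k : comPzRingType) (A : algebra k).

Record rmodule := RModule {
  rmod_car :> lmodType k;
  rmod_act : {linear rmod_car ⊗ A -> rmod_car};
  rmod_actA : forall m a b,
    rmod_act (rmod_act (m ⊗ₜ a) ⊗ₜ b) = rmod_act (m ⊗ₜ μ[A] (a ⊗ₜ b));
  rmod_act1 : forall m, rmod_act (m ⊗ₜ alg_one A) = m }.

Record rmod_hom (M N : rmodule) := RModHom {
  rmod_fun :> {linear M -> N};
  rmod_funP : forall m a,
    rmod_fun (rmod_act M (m ⊗ₜ a)) = rmod_act N (rmod_fun m ⊗ₜ a) }.

Lemma rmod_hom_ext M N (f g : rmod_hom M N) : f =1 g -> f = g.
Proof.
case: f g => [f fP] [g gP] /= fg.
have efg : f = g by exact/linear_ext.
by case: _ / efg gP {fg} => gP; congr RModHom; apply: Prop_irrelevance.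
Qed.

Lemma rmod_id_subproof (M : rmodule) m a :
  idm M (rmod_act M (m ⊗ₜ a)) = rmod_act M (idm M m ⊗ₜ a).
Proof. by []. Qed.

Definition rmod_id M : rmod_hom M M := RModHom (@rmod_id_subproof M).

Lemma rmod_comp_subproof M N P (g : rmod_hom N P) (f : rmod_hom M N) m a :
  (g \o f) (rmod_act M (m ⊗ₜ a)) = rmod_act P ((g \o f) m ⊗ₜ a).
Proof. by rewrite /= !rmod_funP. Qed.

Definition rmod_comp M N P (g : rmod_hom N P) (f : rmod_hom M N) : rmod_hom M P :=
  @RModHom M P (g \o f) (rmod_comp_subproof g f).

Program Definition rmod_category : category :=
  @Category rmodule rmod_hom rmod_id rmod_comp _ _ _.
Next Obligation. by apply: rmod_hom_ext. Qed.
Next Obligation. by apply: rmod_hom_ext. Qed.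
Next Obligation. by apply: rmod_hom_ext. Qed.

End RightModules.

Section EntwinedModules.
Variables (k : comPzRingType) (A : algebra k) (C : coalgebra k).
Variable (e : entwining A C).

(* (m ⊗ c)·a = m·a_α ⊗ c^α *)
Definition entw_act (M : rmodule A) : (M ⊗ C) ⊗ A -> M ⊗ C :=
  (rmod_act M ⊗ₘ idm C) \o tassocV \o (idm M ⊗ₘ psi e) \o tassoc.
Arguments entw_act : clear implicits.
Arguments entw_act M _ : simpl never.
HB.instance Definition _ (M : rmodule A) := GRing.Linear.on (entw_act M).

(* The last condition reads ρ(m·a) = m_(0)·a_α ⊗ m_(1)^α. *)
Record emodule := EModule {
  emod_mod :> rmodule A;
  emod_coact : {linear emod_mod -> emod_mod ⊗ C};
  emod_coactA : forall m,
    tassoc ((emod_coact ⊗ₘ idm C) (emod_coact m)) =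
    (idm emod_mod ⊗ₘ Δ[C]) (emod_coact m);
  emod_coact1 : forall m, trunit ((idm emod_mod ⊗ₘ ε[C]) (emod_coact m)) = m;
  emod_compat : forall m a,
    emod_coact (rmod_act emod_mod (m ⊗ₜ a)) =
    entw_act emod_mod (emod_coact m ⊗ₜ a) }.

Record emod_hom (M N : emodule) := EModHom {
  emod_fun :> rmod_hom M N;
  emod_funP : forall m,
    emod_coact N (emod_fun m) = (emod_fun ⊗ₘ idm C) (emod_coact M m) }.

Lemma emod_hom_ext M N (f g : emod_hom M N) : f =1 g -> f = g.
Proof.
case: f g => [f fP] [g gP] /= fg.
have efg : f = g by exact/rmod_hom_ext.
by case: _ / efg gP {fg} => gP; congr EModHom; apply: Prop_irrelevance.
Qed.

Lemma emod_id_subproof (M : emodule) m :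
  emod_coact M (rmod_id M m) = (rmod_id M ⊗ₘ idm C) (emod_coact M m).
Proof. by rewrite tmap_id. Qed.

Definition emod_id M : emod_hom M M := EModHom (@emod_id_subproof M).

Lemma emod_comp_subproof M N P (g : emod_hom N P) (f : emod_hom M N) m :
  emod_coact P (rmod_comp g f m) = (rmod_comp g f ⊗ₘ idm C) (emod_coact M m).
Proof. by rewrite /= !emod_funP; apply: tmap_comp. Qed.

Definition emod_comp M N P (g : emod_hom N P) (f : emod_hom M N) : emod_hom M P :=
  EModHom (emod_comp_subproof g f).

Program Definition emod_category : category :=
  @Category emodule emod_hom emod_id emod_comp _ _ _.
Next Obligation. by apply: emod_hom_ext. Qed.
Next Obligation. by apply: emod_hom_ext. Qed.
Next Obligation. by apply: emod_hom_ext. Qed.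

Lemma entw_actE (M : rmodule A) m c a :
  entw_act M ((m ⊗ₜ c) ⊗ₜ a) =
  (rmod_act M ⊗ₘ idm C) (tassocV (m ⊗ₜ psi e (c ⊗ₜ a))).
Proof. by rewrite /entw_act /= tassocE tmapE. Qed.

Section Free.
Variable M : rmodule A.

Lemma entw_actA x a b :
  entw_act M (entw_act M (x ⊗ₜ a) ⊗ₜ b) = entw_act M (x ⊗ₜ μ[A] (a ⊗ₜ b)).
Proof.
elim/tensor_ind: x => [m c|x y]; last by rewrite !(tensDl, linearD) /= => -> ->.
have := psi_mul e (c ⊗ₜ (a ⊗ₜ b)); rewrite tassocVE !tmapE /=.
rewrite !entw_actE => ->.
elim/tensor_ind: (psi e (c ⊗ₜ a)) => [a' c'|x y]; last first.
  by rewrite !(tensDl, tensDr, linearD) /= => -> ->.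
rewrite tassocVE tmapE entw_actE tassocE tmapE.
elim/tensor_ind: (psi e (c' ⊗ₜ b)) => [b' d|x y]; last first.
  by rewrite !(tensDl, tensDr, linearD) /= => -> ->.
by rewrite !(tassocVE, tmapE) rmod_actA.
Qed.

Lemma entw_act1 x : entw_act M (x ⊗ₜ alg_one A) = x.
Proof.
elim/tensor_ind: x => [m c|x y]; last by rewrite tensDl linearD /= => -> ->.
by rewrite entw_actE psi_one tassocVE tmapE rmod_act1.
Qed.

Definition free_rmod : rmodule A := RModule entw_actA entw_act1.

Definition free_coact : free_rmod -> free_rmod ⊗ C :=
  tassocV \o (idm M ⊗ₘ Δ[C]).
Arguments free_coact : simpl never.
HB.instance Definition _ := GRing.Linear.on free_coact.

Lemma free_coactE m c : free_coact (m ⊗ₜ c) = tassocV (m ⊗ₜ Δ[C] c).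
Proof. by rewrite /free_coact /= tmapE. Qed.

Lemma free_coactA x :
  tassoc ((free_coact ⊗ₘ idm C) (free_coact x)) =
  (idm free_rmod ⊗ₘ Δ[C]) (free_coact x).
Proof.
elim/tensor_ind: x => [m c|x y]; last by rewrite !linearD /= => -> ->.
have Kr (y : C ⊗ C) : (idm free_rmod ⊗ₘ Δ[C]) (tassocV (m ⊗ₜ y)) =
    tassocV (m ⊗ₜ (idm C ⊗ₘ Δ[C]) y).
  elim/tensor_ind: y => [c1 c2|y z]; last first.
    by rewrite !(tensDr, linearD) /= => -> ->.
  by rewrite tassocVE !tmapE /= tassocVE.
have Kl (y : C ⊗ C) : tassoc ((free_coact ⊗ₘ idm C) (tassocV (m ⊗ₜ y))) =
    tassocV (m ⊗ₜ tassoc ((Δ[C] ⊗ₘ idm C) y)).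
  elim/tensor_ind: y => [c1 c2|y z]; last first.
    by rewrite !(tensDr, linearD) /= => -> ->.
  rewrite tassocVE !tmapE /= free_coactE.
  elim/tensor_ind: (Δ[C] c1) => [d1 d2|y z]; last first.
    by rewrite !(tensDr, tensDl, linearD) /= => -> ->.
  by rewrite !(tassocVE, tassocE).
by rewrite free_coactE Kl Kr coalg_comulA.
Qed.

Lemma free_coact1 x : trunit ((idm free_rmod ⊗ₘ ε[C]) (free_coact x)) = x.
Proof.
elim/tensor_ind: x => [m c|x y]; last by rewrite !linearD /= => -> ->.
have K (y : C ⊗ C) : trunit ((idm free_rmod ⊗ₘ ε[C]) (tassocV (m ⊗ₜ y))) =
    m ⊗ₜ trunit ((idm C ⊗ₘ ε[C]) y).
  elim/tensor_ind: y => [c1 c2|y z]; last first.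
    by rewrite !(tensDr, linearD) /= => -> ->.
  by rewrite tassocVE !tmapE /= !trunitE tensZr.
by rewrite free_coactE K coalg_counitr.
Qed.

Lemma free_compat x a :
  free_coact (rmod_act free_rmod (x ⊗ₜ a)) =
  entw_act free_rmod (free_coact x ⊗ₜ a).
Proof.
elim/tensor_ind: x => [m c|x y]; last by rewrite !(tensDl, linearD) /= => -> ->.
pose G (z : A ⊗ (C ⊗ C)) : (M ⊗ C) ⊗ C :=
  tassocV ((rmod_act M ⊗ₘ idm (C ⊗ C)) (tassocV (m ⊗ₜ z))).
have GD y z : G (y + z) = G y + G z by rewrite /G tensDr !linearD.
have GE a' d1 d2 : G (a' ⊗ₜ (d1 ⊗ₜ d2)) = (rmod_act M (m ⊗ₜ a') ⊗ₜ d1) ⊗ₜ d2.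
  by rewrite /G tassocVE tmapE tassocVE.
have -> : free_coact (rmod_act free_rmod ((m ⊗ₜ c) ⊗ₜ a)) =
    G ((idm A ⊗ₘ Δ[C]) (psi e (c ⊗ₜ a))).
  rewrite /= entw_actE; elim/tensor_ind: (psi e (c ⊗ₜ a)) => [a' c'|y z]; last first.
    by rewrite !(tensDr, linearD) /= GD => -> ->.
  rewrite tassocVE !tmapE /= free_coactE.
  elim/tensor_ind: (Δ[C] c') => [d1 d2|y z]; last first.
    by rewrite !(tensDr, linearD) /= GD => -> ->.
  by rewrite GE tassocVE.
rewrite psi_comul tmapE free_coactE /=.
elim/tensor_ind: (Δ[C] c) => [c1 c2|y z]; last first.
  by rewrite !(tensDr, tensDl, linearD) /= GD => -> ->.
rewrite tassocVE entw_actE tassocE tmapE /=.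
elim/tensor_ind: (psi e (c2 ⊗ₜ a)) => [a' c'|y z]; last first.
  by rewrite !(tensDr, tensDl, linearD) /= GD => -> ->.
rewrite !tassocVE !tmapE /= entw_actE.
elim/tensor_ind: (psi e (c1 ⊗ₜ a')) => [a'' c''|y z]; last first.
  by rewrite !(tensDr, tensDl, linearD) /= GD => -> ->.
by rewrite tassocE GE tassocVE tmapE.
Qed.

Definition free_emod : emodule := EModule free_coactA free_coact1 free_compat.
End Free.

Section FreeMap.
Variables (M N : rmodule A) (f : rmod_hom M N).

Lemma free_map_act x a :
  (f ⊗ₘ idm C) (rmod_act (free_emod M) (x ⊗ₜ a)) =
  rmod_act (free_emod N) ((f ⊗ₘ idm C) x ⊗ₜ a).
Proof.
elim/tensor_ind: x => [m c|x y]; last by rewrite !(tensDl, linearD) /= => -> ->.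
rewrite tmapE /= !entw_actE.
elim/tensor_ind: (psi e (c ⊗ₜ a)) => [a' c'|x y]; last first.
  by rewrite !(tensDr, linearD) /= => -> ->.
by rewrite !(tassocVE, tmapE) rmod_funP.
Qed.

Definition free_rmod_map : rmod_hom (free_emod M) (free_emod N) :=
  @RModHom _ _ (free_emod M) (free_emod N) (f ⊗ₘ idm C) free_map_act.

Lemma free_map_coact x :
  emod_coact (free_emod N) (free_rmod_map x) =
  (free_rmod_map ⊗ₘ idm C) (emod_coact (free_emod M) x).
Proof.
elim/tensor_ind: x => [m c|x y]; last by rewrite !linearD /= => -> ->.
rewrite /= tmapE !free_coactE.
elim/tensor_ind: (Δ[C] c) => [c1 c2|x y]; last first.
  by rewrite !(tensDr, linearD) /= => -> ->.
by rewrite !(tassocVE, tmapE) /= tmapE.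
Qed.

Definition free_map : emod_hom (free_emod M) (free_emod N) := EModHom free_map_coact.
End FreeMap.

Program Definition free_functor : functor (rmod_category A) emod_category :=
  @Functor (rmod_category A) emod_category free_emod free_map _ _.
Next Obligation. by apply: emod_hom_ext => x /=; rewrite tmap_id. Qed.
Next Obligation. by apply: emod_hom_ext => x /=; symmetry; apply: tmap_comp. Qed.

End EntwinedModules.

Section Integrals.
Variables (k : comPzRingType) (A : algebra k) (C : coalgebra k).
Variable (e : entwining A C).

(* For z = Σ_i a_i ⊗ c_i: Σ_i a a_i ⊗ c_i = Σ_i a_i ψ(c_i ⊗ a). *)
Definition is_integral (z : A ⊗ C) : Prop := forall a : A,
  (μ[A] ⊗ₘ idm C) (tassocV (a ⊗ₜ z)) =
  (μ[A] ⊗ₘ idm C) (tassocV ((idm A ⊗ₘ psi e) (tassoc (z ⊗ₜ a)))).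

(* Σ_i a_i ε(c_i) = 1. *)
Definition normalised (z : A ⊗ C) : Prop :=
  trunit ((idm A ⊗ₘ ε[C]) z) = alg_one A.
End Integrals.

(* Main.v *)
Require Import Defs.
From HB Require Import structures.
From mathcomp Require Import all_boot all_algebra.

Set Implicit Arguments.
Unset Strict Implicit.
Unset Printing Implicit Defensive.

Import GRing.Theory.
Local Open Scope ring_scope.

(** The functor [- ⊗ C] is right adjoint to the functor forgetting the
    coaction: the unit at an entwined module [N] is its coaction
    [N -> N ⊗ C], and the counit at a module [M] is [M ⊗ ε : M ⊗ C -> M].
    As for every right adjoint, separability amounts to a natural section
    [ν_M : M -> M ⊗ C] of the counit.  Since every [m : M] is the image of [1]
    under the module map [a |-> m·a] from the regular module ([orbit_map]), a
    natural [ν] is determined by [z = ν_A(1)], through [ν_M(m) = m·z].  Module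
    linearity of [ν_A] says [ν_A(a) = z·a] and naturality with respect to left
    multiplications says [ν_A(a) = a·z]: together, [z] is an integral.  That
    [ν_A] is a section of the counit says that [z] is normalised.

    Given a normalised integral [z], the retraction of [- ⊗ C] on morphisms
    sends [h : M ⊗ C -> N ⊗ C] to [(N ⊗ ε) ∘ h ∘ ν_M].  Conversely, given a
    natural retraction [P], applying [P] to the coaction of [A ⊗ C], seen as a
    morphism from [A ⊗ C] to [(A ⊗ C) ⊗ C], yields a module map
    [ν_A : A -> A ⊗ C] that commutes with left multiplications and is a section
    of the counit, so that [ν_A(1)] is a normalised integral. *)

Section RegularModule.
Variables (k : comPzRingType) (A : algebra k).

Definition regular_rmod : rmodule A :=
  RModule (rmod_act := μ[A]) (@alg_mulA k A) (@alg_mul1r k A).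

Section Orbit.
Variables (M : rmodule A) (m : M).

Definition orbit_fun (a : A) : M := rmod_act M (m ⊗ₜ a).

Lemma orbit_fun_linear : linear orbit_fun.
Proof. by move=> c a b; rewrite /orbit_fun tensDr tensZr linearP. Qed.

HB.instance Definition _ :=
  GRing.isLinear.Build k A M *:%R orbit_fun orbit_fun_linear.

Lemma orbit_funP (b a : A) :
  orbit_fun (rmod_act regular_rmod (b ⊗ₜ a)) = rmod_act M (orbit_fun b ⊗ₜ a).
Proof. by rewrite /orbit_fun rmod_actA. Qed.

Definition orbit_map : rmod_hom regular_rmod M :=
  @RModHom k A regular_rmod M orbit_fun orbit_funP.

Lemma orbit_map1 : orbit_map (alg_one A) = m.
Proof. exact: rmod_act1. Qed.
End Orbit.

Lemma rmod_comp_orbit (M N : rmodule A) (f : rmod_hom M N) (m : M) :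
  rmod_comp f (orbit_map m) = orbit_map (f m).
Proof. by apply: rmod_hom_ext => a; apply: rmod_funP. Qed.
End RegularModule.

Section Adjunction.
Variables (k : comPzRingType) (A : algebra k) (C : coalgebra k).
Variable e : entwining A C.

Lemma free_map_comp (M N P : rmodule A) (g : rmod_hom N P) (f : rmod_hom M N) x :
  free_map e (rmod_comp g f) x = free_map e g (free_map e f x).
Proof. by symmetry; apply: tmap_comp. Qed.

Section Counit.
Variable M : rmodule A.

Definition counit_fun : free_rmod e M -> M := trunit \o (idm M ⊗ₘ ε[C]).
HB.instance Definition _ := GRing.Linear.on counit_fun.

Lemma counit_funE (m : M) (c : C) : counit_fun (m ⊗ₜ c) = (ε[C] c : k) *: m.
Proof. by rewrite /counit_fun /= tmapE trunitE. Qed.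

(** This is where the compatibility of [ψ] with the counit enters. *)
Lemma counit_funP (x : free_rmod e M) (a : A) :
  counit_fun (rmod_act (free_rmod e M) (x ⊗ₜ a)) =
  rmod_act M (counit_fun x ⊗ₜ a).
Proof.
elim/tensor_ind: x => [m c|x y]; last by rewrite !(tensDl, linearD) /= => -> ->.
rewrite counit_funE tensZl linearZ /= entw_actE.
have -> (y : A ⊗ C) :
    counit_fun ((rmod_act M ⊗ₘ idm C) (tassocV (m ⊗ₜ y))) =
    rmod_act M (m ⊗ₜ trunit ((idm A ⊗ₘ ε[C]) y)).
  elim/tensor_ind: y => [b d|x y]; last by rewrite !(tensDr, linearD) /= => -> ->.
  by rewrite tassocVE !tmapE counit_funE trunitE tensZr linearZ.
by rewrite psi_counit tmapE tlunitE tensZr linearZ.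
Qed.

Definition counit_map : rmod_hom (free_rmod e M) M :=
  @RModHom k A (free_rmod e M) M counit_fun counit_funP.
End Counit.

Lemma counit_map_nat (M N : rmodule A) (f : rmod_hom M N) x :
  counit_map N (free_map e f x) = f (counit_map M x).
Proof.
elim/tensor_ind: x => [m c|x y]; last by rewrite !linearD /= => -> ->.
by rewrite /= tmapE !counit_funE linearZ.
Qed.

Section Coaction.
Variable N : emodule e.

Definition coact_rmod_map : rmod_hom N (free_emod e N) :=
  @RModHom k A N (free_rmod e N) (@emod_coact k A C e N) (@emod_compat k A C e N).

(** Coassociativity of [N], read as colinearity of its coaction. *)
Lemma coact_map_colinear (n : N) :
  emod_coact (free_emod e N) (coact_rmod_map n) =
  (coact_rmod_map ⊗ₘ idm C) (emod_coact N n).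
Proof.
have tassocK (x : (N ⊗ C) ⊗ C) : tassocV (tassoc x) = x.
  elim/tensor_ind: x => [x c|x y]; last by rewrite !linearD /= => -> ->.
  elim/tensor_ind: x => [m d|x y]; last by rewrite !(tensDl, linearD) /= => -> ->.
  by rewrite tassocE tassocVE.
by rewrite -[RHS]tassocK emod_coactA.
Qed.

Definition coact_map : emod_hom N (free_emod e N) := EModHom coact_map_colinear.
End Coaction.

(** The triangle identity of the adjunction on the side of [- ⊗ C]. *)
Lemma free_counit_coact (M : rmodule A) (x : free_emod e M) :
  free_map e (counit_map M) (coact_map (free_emod e M) x) = x.
Proof.
elim/tensor_ind: x => [m c|x y]; last by rewrite !linearD /= => -> ->.
rewrite /= free_coactE.
have -> (y : C ⊗ C) : (counit_map M ⊗ₘ idm C) (tassocV (m ⊗ₜ y)) =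
    m ⊗ₜ tlunit ((ε[C] ⊗ₘ idm C) y).
  elim/tensor_ind: y => [c1 c2|y z]; last by rewrite !(tensDr, linearD) /= => -> ->.
  by rewrite tassocVE !tmapE /= counit_funE tlunitE tensZl tensZr.
by rewrite coalg_counitl.
Qed.

End Adjunction.

Section Translation.
Variables (k : comPzRingType) (A : algebra k) (C : coalgebra k).
Variables (e : entwining A C) (z : A ⊗ C).

Section Module.
Variable M : rmodule A.

Definition translation (m : M) : free_rmod e M :=
  (rmod_act M ⊗ₘ idm C) (tassocV (m ⊗ₜ z)).

Lemma translation_linear : linear translation.
Proof. by move=> c m n; rewrite /translation tensDl tensZl !linearP. Qed.

HB.instance Definition _ :=
  GRing.isLinear.Build k M (free_rmod e M) *:%R translation translation_linear.

(** The element [m·z] is the image of [z] under the functor [- ⊗ C] applied to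
    a module map; its naturality and linearity in [m] follow from this. *)
Lemma translationE (m : M) : translation m = free_map e (orbit_map m) z.
Proof.
rewrite /translation; elim/tensor_ind: z => [a c|x y].
  by rewrite tassocVE /= !tmapE.
by rewrite !(tensDr, linearD) /= => -> ->.
Qed.
End Module.

Lemma translation_nat (M N : rmodule A) (f : rmod_hom M N) (m : M) :
  free_map e f (translation m) = translation (f m).
Proof. by rewrite !translationE -free_map_comp rmod_comp_orbit. Qed.

(** In terms of the regular module, an integral is an element on which [A]
    acts identically from the left and from the right. *)
Lemma is_integralE : is_integral e z <->
  forall a : A, translation (M := regular_rmod A) a =
                rmod_act (free_rmod e (regular_rmod A)) (z ⊗ₜ a).
Proof. by []. Qed.

Lemma normalisedE : normalised z <->
  counit_map e (regular_rmod A) z = alg_one A.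
Proof. by []. Qed.

Lemma translationP (M : rmodule A) (m : M) (a : A) : is_integral e z ->
  translation (rmod_act M (m ⊗ₜ a)) =
  rmod_act (free_rmod e M) (translation m ⊗ₜ a).
Proof.
move=> /is_integralE zP.
rewrite (translationE m) -(rmod_funP (free_map e (orbit_map m))) -zP.
by rewrite translation_nat.
Qed.

Lemma counit_translation (M : rmodule A) (m : M) : normalised z ->
  counit_map e M (translation m) = m.
Proof.
by move=> /normalisedE z1; rewrite translationE counit_map_nat z1 orbit_map1.
Qed.

Definition translation_map (M : rmodule A) (zP : is_integral e z) :
    rmod_hom M (free_rmod e M) :=
  @RModHom k A M (free_rmod e M) (@translation M)
    (fun m a => translationP m a zP).

End Translation.

(** The translations [m |-> m·z] form a natural section [ν] of the counit, and
    [h |-> counit ∘ h ∘ ν] is natural in [h] because [ν] and the counit are;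
    it maps [f ⊗ C] to [counit ∘ ν ∘ f = f]. *)
Lemma separable_of_integral (k : comPzRingType) (A : algebra k)
    (C : coalgebra k) (e : entwining A C) (z : A ⊗ C) :
  is_integral e z -> normalised z -> separable (free_functor e).
Proof.
move=> zP z1.
exists (fun (M N : rmodule A) (h : emod_hom (free_emod e M) (free_emod e N)) =>
  rmod_comp (counit_map e N) (rmod_comp h (translation_map M zP))).
split=> [M M' N N' f g h | M N f]; apply: rmod_hom_ext => m.
  transitivity (counit_map e N' (free_map e g
    (h (free_map e f (translation e z m))))); first by [].
  by rewrite counit_map_nat translation_nat.
transitivity (counit_map e N (free_map e f (translation e z m))); first by [].
by rewrite translation_nat counit_translation.
Qed.

(** Here [ν = P(ρ)], for [ρ] the coaction of [A ⊗ C].  Naturality of [P] moves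
    a module map past it on either side, so an identity between composites of
    [ρ] with maps [f ⊗ C] becomes one between composites of [ν] with maps [f].
    Naturality of [ρ] thus gives [(l ⊗ C) ∘ ν = ν ∘ l] for [l] a left
    multiplication, and the triangle identity gives [(A ⊗ ε) ∘ ν = id]. *)
Lemma integral_of_separable (k : comPzRingType) (A : algebra k)
    (C : coalgebra k) (e : entwining A C) :
  separable (free_functor e) ->
  exists z : A ⊗ C, is_integral e z /\ normalised z.
Proof.
case=> P [Pnat PF].
have Pl (X Y Y' : rmod_category A) (g : Defs.hom Y Y')
    (h : Defs.hom (free_functor e X) (free_functor e Y)) :
    P X Y' (fmap (free_functor e) g \oc h) = g \oc P X Y h.
  by have := Pnat X X Y Y' (idC X) g h; rewrite fmap1 !compC1.
have Pr (X X' Y : rmod_category A) (f : Defs.hom X' X)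
    (h : Defs.hom (free_functor e X) (free_functor e Y)) :
    P X' Y (h \oc fmap (free_functor e) f) = P X Y h \oc f.
  by have := Pnat X X' Y Y f (idC Y) h; rewrite fmap1 !comp1C.
pose R : rmod_category A := regular_rmod A.
pose FR : rmod_category A := free_rmod e (regular_rmod A).
pose rho : Defs.hom (free_functor e R) (free_functor e FR) :=
  coact_map (free_emod e (regular_rmod A)).
pose nu : rmod_hom (regular_rmod A) (free_rmod e (regular_rmod A)) := P R FR rho.
exists (nu (alg_one A)); split.
  apply/is_integralE => a.
  pose l : Defs.hom R R := orbit_map (M := regular_rmod A) a.
  pose Fl : Defs.hom FR FR := emod_fun (free_map e l).
  (* Colinearity of l ⊗ C, read as naturality of the coaction. *)
  have rho_l : fmap (free_functor e) Fl \oc rho =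
      rho \oc fmap (free_functor e) l.
    by apply: emod_hom_ext => x; symmetry; apply: free_map_coact.
  have nu_l : Fl \oc P R FR rho = P R FR rho \oc l by rewrite -Pl rho_l Pr.
  rewrite translationE -(rmod_funP nu).
  transitivity (rmod_comp nu l (alg_one A)).
    by rewrite -[rmod_comp nu l]nu_l.
  by congr (nu _); rewrite /= /orbit_fun /= alg_mul1l alg_mul1r.
apply/normalisedE.
pose eps : Defs.hom FR R := counit_map e (regular_rmod A).
have counit_nu : eps \oc P R FR rho = idC R.
  rewrite -Pl -[RHS]PF; congr (P _ _ _).
  by apply: emod_hom_ext => x; rewrite fmap1; apply: free_counit_coact.
transitivity (rmod_comp (counit_map e (regular_rmod A)) nu (alg_one A)) => //.
by rewrite [rmod_comp _ _]counit_nu.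
Qed.

Theorem theorem4p3 (k : comPzRingType) (A : algebra k) (C : coalgebra k)
    (e : entwining A C) :
  separable (free_functor e) <->
  exists z : A ⊗ C, is_integral e z /\ normalised z.
Proof.
split=> [|[z [zP z1]]]; first exact: integral_of_separable.
exact: separable_of_integral zP z1.
Qed.
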